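(* Let $(\mathfrak g,[\cdot,\cdot]_{\mathfrak g},\triangleright)$ be an inner post-Lie algebra over a field $\mathbb K$, with sub-adjacent Lie algebra $\mathfrak g_\triangleright$ and center $Z(\mathfrak g)$ of $(\mathfrak g,[\cdot,\cdot]_{\mathfrak g})$. Then $(\mathfrak g,[\cdot,\cdot]_{\mathfrak g},\triangleright)$ is induced by a Rota-Baxter operator (of weight $1$) on $(\mathfrak g,[\cdot,\cdot]_{\mathfrak g})$, i.e. there is a Rota-Baxter operator $R:\mathfrak g\to\mathfrak g$ of weight $1$ with $x\triangleright y=[R(x),y]_{\mathfrak g}$ for all $x,y\in\mathfrak g$, if and only if its obstruction class $[\kappa]\in H^2(\mathfrak g_\triangleright,Z(\mathfrak g))$ is trivial.
   Context: A post-Lie algebra $(\mathfrak g,[\cdot,\cdot]_{\mathfrak g},\triangleright)$ is a Lie algebra $(\mathfrak g,[\cdot,\cdot]_{\mathfrak g})$ with a bilinear product $\triangleright$ such that for all $x,y,z\in\mathfrak g$: $x\triangleright[y,z]_{\mathfrak g}=[x\triangleright y,z]_{\mathfrak g}+[y,x\triangleright z]_{\mathfrak g}$ and $([x,y]_{\mathfrak g}+x\triangleright y-y\triangleright x)\triangleright z=x\triangleright(y\triangleright z)-y\triangleright(x\triangleright z)$. Its sub-adjacent Lie algebra $\mathfrak g_\triangleright$ is the vector space $\mathfrak g$ with Lie bracket $[x,y]_\triangleright=x\triangleright y-y\triangleright x+[x,y]_{\mathfrak g}$. Put $L_\triangleright(x)(y)=x\triangleright y$; each $L_\triangleright(x)$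 is a derivation of $(\mathfrak g,[\cdot,\cdot]_{\mathfrak g})$. The post-Lie algebra is inner if $L_\triangleright(x)$ is an inner derivation of $(\mathfrak g,[\cdot,\cdot]_{\mathfrak g})$ for every $x\in\mathfrak g$. A Rota-Baxter operator of weight $1$ on $(\mathfrak g,[\cdot,\cdot]_{\mathfrak g})$ is a linear map $R:\mathfrak g\to\mathfrak g$ with $[R(x),R(y)]_{\mathfrak g}=R([R(x),y]_{\mathfrak g}+[x,R(y)]_{\mathfrak g}+[x,y]_{\mathfrak g})$ for all $x,y$. Obstruction class: for an inner post-Lie algebra choose a linear map $\phi:\mathfrak g\to\mathfrak g$ with $x\triangleright y=[\phi(x),y]_{\mathfrak g}$ for all $x,y$ (such $\phi$ exists). Define $\kappa:\wedge^2\mathfrak g_\triangleright\to Z(\mathfrak g)$ by $\kappa(x,y)=[\phi(x),\phi(y)]_{\mathfrak g}-\phi([x,y]_\triangleright)$. This is a $2$-cocycle on $\mathfrak g_\triangleright$ with coefficients in the trivial representation $Z(\mathfrak g)$, and its class $[\kappa]$ in the Chevalley-Eilenberg cohomology $H^2(\mathfrak g_\triangleright,Z(\mathfrak g))$ (trivial coefficients) does not depend on the choice of $\phi$; it is called the obstruction class. The coboundary of a linear map $t:\mathfrak g_\triangleright\to Z(\mathfrak g)$ is $(\mathrm dt)(x,y)=-t([x,y]_\triangleright)$. *)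

(* Defs.v *)
From HB Require Import structures.
From mathcomp Require Import all_boot all_algebra.
From mathcomp Require Import generic_quotient ring_quotient.
From mathcomp Require Import boolp classical_sets functions.

Set Implicit Arguments.
Unset Strict Implicit.
Unset Printing Implicit Defensive.

Import GRing.Theory.
Local Open Scope ring_scope.

(* Proves an identity in an abelian group by cancelling opposite terms. *)
Ltac zmod_cancel :=
  apply/eqP; rewrite -subr_eq0; apply/eqP;
  rewrite -[LHS]addr0 ?(opprD, opprK); rewrite -?addrA;
  repeat lazymatch goal with
  | |- - ?a + _ = _ => do ?rewrite [_ + (a + _)]addrCA; rewrite [LHS]addNKr
  | |- ?a + _ = _ => do ?rewrite [_ + (- a + _)]addrCA; rewrite [LHS]addKr
  end; done.

Reserved Notation "[ 'lie' x , y ]" (format "[ 'lie'  x ,  y ]").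
Reserved Notation "x |> y" (at level 40, left associativity).

HB.mixin Record isLieAlgebra (K : fieldType) g of GRing.Lmodule K g := {
  lie_bracket : g -> g -> g;
  lie_linearl : forall z, linear (fun x => lie_bracket x z);
  lie_linearr : forall x, linear (lie_bracket x);
  liexx : forall x, lie_bracket x x = 0;
  lie_jacobi : forall x y z,
    lie_bracket x (lie_bracket y z) + lie_bracket y (lie_bracket z x)
    + lie_bracket z (lie_bracket x y) = 0
}.

#[short(type="lieAlgType")]
HB.structure Definition LieAlgebra (K : fieldType) :=
  {g of GRing.Lmodule K g & isLieAlgebra K g}.

Notation "[ 'lie' x , y ]" := (lie_bracket x y) : ring_scope.

HB.mixin Record isPostLie (K : fieldType) g of LieAlgebra K g := {
  postlie_prod : g -> g -> g;
  postlie_linearl : forall z, linear (fun x => postlie_prod x z);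
  postlie_linearr : forall x, linear (postlie_prod x);
  postlie_der : forall x y z : g,
    postlie_prod x [lie y, z]
    = [lie postlie_prod x y, z] + [lie y, postlie_prod x z];
  postlie_assoc : forall x y z : g,
    postlie_prod ([lie x, y] + postlie_prod x y - postlie_prod y x) z
    = postlie_prod x (postlie_prod y z) - postlie_prod y (postlie_prod x z)
}.

#[short(type="postLieType")]
HB.structure Definition PostLie (K : fieldType) :=
  {g of LieAlgebra K g & isPostLie K g}.

Notation "x |> y" := (postlie_prod x y) : ring_scope.

Section LieTheory.
Variables (K : fieldType) (g : lieAlgType K).
Implicit Types x y z : g.

Lemma lieDl x y z : [lie x + y, z] = [lie x, z] + [lie y, z].
Proof. by have := lie_linearl z 1 x y; rewrite !scale1r. Qed.

Lemma lieDr x y z : [lie x, y + z] = [lie x, y] + [lie x, z].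
Proof. by have := lie_linearr x 1 y z; rewrite !scale1r. Qed.

Lemma lie0r x : [lie x, 0] = 0.
Proof. by apply: (addIr [lie x, 0]); rewrite -lieDr !add0r. Qed.

Lemma lie0l x : [lie 0, x] = 0.
Proof. by apply: (addIr [lie 0, x]); rewrite -lieDl !add0r. Qed.

Lemma lieZl a x y : [lie a *: x, y] = a *: [lie x, y].
Proof. by have := lie_linearl y a x 0; rewrite lie0l !addr0. Qed.

Lemma lieZr a x y : [lie x, a *: y] = a *: [lie x, y].
Proof. by have := lie_linearr x a y 0; rewrite lie0r !addr0. Qed.

Lemma lieNl x y : [lie - x, y] = - [lie x, y].
Proof. by rewrite -scaleN1r lieZl scaleN1r. Qed.

Lemma lieNr x y : [lie x, - y] = - [lie x, y].
Proof. by rewrite -scaleN1r lieZr scaleN1r. Qed.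

Lemma lieC x y : [lie x, y] = - [lie y, x].
Proof.
apply/eqP; rewrite -addr_eq0; apply/eqP.
by have := liexx (x + y); rewrite lieDl !lieDr !liexx add0r addr0.
Qed.

Lemma lie_jacobil x y z : [lie [lie x, y], z] = [lie x, [lie y, z]] - [lie y, [lie x, z]].
Proof.
have := lie_jacobi x y z.
by rewrite (lieC z x) (lieC z [lie x, y]) lieNr => /eqP; rewrite subr_eq0 => /eqP.
Qed.

Lemma lie_ce x y z :
  - [lie [lie x, y], z] + [lie [lie x, z], y] - [lie [lie y, z], x] = 0.
Proof.
rewrite -(lie_jacobi x y z) (lieC [lie x, y]) (lieC [lie x, z]) (lieC [lie y, z]).
by rewrite (lieC z x) lieNr; zmod_cancel.
Qed.

Definition inner_derivation (D : g -> g) : Prop :=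
  exists u : g, forall y, D y = [lie u, y].

Definition rota_baxter1 (R : {linear g -> g}) : Prop :=
  forall x y, [lie R x, R y] = R ([lie R x, y] + [lie x, R y] + [lie x, y]).

Definition lie_center : {pred g} := fun z => `[< forall x, [lie z, x] = 0 >].

Lemma lie_centerP z : reflect (forall x, [lie z, x] = 0) (z \in lie_center).
Proof. exact: asboolP. Qed.

Fact lie_center_submod : submod_closed lie_center.
Proof.
split; first by apply/lie_centerP => x; rewrite lie0l.
move=> a u v /lie_centerP hu /lie_centerP hv; apply/lie_centerP => x.
by rewrite lieDl lieZl hu hv scaler0 addr0.
Qed.
HB.instance Definition _ :=
  GRing.isSubmodClosed.Build K g lie_center lie_center_submod.

Definition lie_centerT : Type := {z : g | z \in lie_center}.
HB.instance Definition _ := [isSub of lie_centerT for sval].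
HB.instance Definition _ := [Choice of lie_centerT by <:].
HB.instance Definition _ := [SubChoice_isSubLmodule of lie_centerT by <:].

End LieTheory.

Section Cohomology.
Variables (K : fieldType) (h : lieAlgType K) (V : lmodType K).

(* Chevalley-Eilenberg differentials in degrees 1 and 2, for the trivial
   representation V. *)
Definition ce_d1 (t : h -> V) : h -> h -> V := fun x y => - t [lie x, y].

Definition ce_d2 (w : h -> h -> V) : h -> h -> h -> V := fun x y z =>
  - w [lie x, y] z + w [lie x, z] y - w [lie y, z] x.

Definition cochain2 (w : h -> h -> V) : Prop :=
  [/\ forall y, linear (fun x => w x y), forall x, linear (w x)
    & forall x, w x x = 0].

Definition cocycle2 : {pred h -> h -> V} := fun w =>
  `[< cochain2 w /\ forall x y z, ce_d2 w x y z = 0 >].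

Lemma cocycle2P w :
  reflect (cochain2 w /\ forall x y z, ce_d2 w x y z = 0) (w \in cocycle2).
Proof. exact: asboolP. Qed.

Fact cocycle2_submod : submod_closed cocycle2.
Proof.
split; first apply/cocycle2P; first (split; first split) => //.
- by move=> y a u v; rewrite /= scaler0 addr0.
- by move=> y a u v; rewrite /= scaler0 addr0.
- by move=> x y z; rewrite /ce_d2 !oppr0 !addr0.
move=> a u v /cocycle2P[[ul ur ua] ud] /cocycle2P[[vl vr va] vd].
apply/cocycle2P; split; first split.
- move=> y b x x'; have /= := ul y b x x'; have /= := vl y b x x'.
  by rewrite !fctE => -> ->; rewrite !scalerDr !scalerA (mulrC a) addrACA.
- move=> y b x x'; have /= := ur y b x x'; have /= := vr y b x x'.
  by rewrite !fctE => -> ->; rewrite !scalerDr !scalerA (mulrC a) addrACA.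
- by move=> x; rewrite !fctE ua va scaler0 addr0.
move=> x y z; have := vd x y z; have := ud x y z; rewrite /ce_d2 !fctE => hu hv.
transitivity (a *: (- u [lie x, y] z + u [lie x, z] y - u [lie y, z] x)
  + (- v [lie x, y] z + v [lie x, z] y - v [lie y, z] x)).
  rewrite !scalerDr !scalerN; zmod_cancel.
by rewrite hu hv scaler0 addr0.
Qed.
HB.instance Definition _ :=
  GRing.isSubmodClosed.Build K (h -> h -> V) cocycle2 cocycle2_submod.

Definition Z2 : Type := {w : h -> h -> V | w \in cocycle2}.
HB.instance Definition _ := [isSub of Z2 for sval].
HB.instance Definition _ := [Choice of Z2 by <:].
HB.instance Definition _ := [SubChoice_isSubLmodule of Z2 by <:].

Definition coboundary2 : {pred Z2} := fun w =>
  `[< exists t : {linear h -> V}, val w = ce_d1 t >].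

Lemma coboundary2P (w : Z2) :
  reflect (exists t : {linear h -> V}, val w = ce_d1 t) (w \in coboundary2).
Proof. exact: asboolP. Qed.

Fact coboundary2_submod : submod_closed coboundary2.
Proof.
split.
  apply/coboundary2P; exists (\0 : {linear h -> V}).
  by apply/funext => x; apply/funext => y; rewrite /ce_d1 /= oppr0.
move=> a u v /coboundary2P[s us] /coboundary2P[t vt]; apply/coboundary2P.
exists (a \*: s \+ t : {linear h -> V}).
have -> : val (a *: u + v) = a *: val u + val v by exact: (linearP val).
rewrite us vt.
by apply/funext => x; apply/funext => y; rewrite /ce_d1 !fctE /= scalerN opprD.
Qed.
HB.instance Definition _ :=
  GRing.isSubmodClosed.Build K Z2 coboundary2 coboundary2_submod.

(* H2 is only given its additive structure. *)
Definition H2 : zmodType := {ideal_quot coboundary2}.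

Definition H2_class (w : Z2) : H2 := (\pi_({ideal_quot coboundary2}) w)%qT.

Lemma eq_H2_class (v w : Z2) :
  H2_class v = H2_class w <-> exists t : {linear h -> V}, val v - val w = ce_d1 t.
Proof.
have E : (v - w \in coboundary2) = (H2_class v == H2_class w).
  exact: Quotient.idealrBE.
rewrite -[val v - val w]raddfB; split => [vw|/coboundary2P].
  by apply/coboundary2P; rewrite E; apply/eqP.
by rewrite E => /eqP.
Qed.

Lemma H2_class_eq0 (w : Z2) :
  H2_class w = 0 <-> exists t : {linear h -> V}, val w = ce_d1 t.
Proof.
have -> : (0 : H2) = H2_class 0 by rewrite /H2_class piE.
by rewrite eq_H2_class (raddf0 val) subr0.
Qed.

End Cohomology.

Section SubAdjacent.
Variables (K : fieldType) (g : postLieType K).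
Implicit Types x y z : g.

Lemma plD x y z : x |> (y + z) = x |> y + x |> z.
Proof. by have := postlie_linearr x 1 y z; rewrite !scale1r. Qed.

Lemma pl0 x : x |> 0 = 0.
Proof. by apply: (addIr (x |> 0)); rewrite -plD !add0r. Qed.

Lemma pl0l x : 0 |> x = 0.
Proof.
apply: (addIr (0 |> x)); rewrite add0r.
by have := postlie_linearl x 1 0 0; rewrite /= !scale1r add0r => <-.
Qed.

Lemma plN x y : x |> (- y) = - (x |> y).
Proof. by apply/eqP; rewrite -addr_eq0 -plD addNr pl0. Qed.

Definition subadj_bracket x y : g := x |> y - y |> x + [lie x, y].

Lemma subadj_pl x y z : subadj_bracket x y |> z = x |> (y |> z) - y |> (x |> z).
Proof.
by rewrite -postlie_assoc; congr (_ |> z); rewrite /subadj_bracket [LHS]addrC addrA.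
Qed.

Fact subadj_linearl z : linear (fun x => subadj_bracket x z).
Proof.
move=> a x y; rewrite /subadj_bracket lieDl lieZl.
have -> := postlie_linearl z a x y; have -> := postlie_linearr z a x y.
by rewrite !scalerDr scalerN; zmod_cancel.
Qed.

Fact subadjxx x : subadj_bracket x x = 0.
Proof. by rewrite /subadj_bracket subrr liexx addr0. Qed.

Lemma subadjC x y : subadj_bracket x y = - subadj_bracket y x.
Proof. by rewrite /subadj_bracket (lieC x y) !opprD opprK [- _ + _]addrC. Qed.

Fact subadj_linearr x : linear (subadj_bracket x).
Proof.
move=> a y z; rewrite subadjC; have -> := subadj_linearl x a y z.
by rewrite opprD -scalerN -!subadjC.
Qed.

Fact subadj_jacobi x y z :
  subadj_bracket x (subadj_bracket y z) + subadj_bracket y (subadj_bracket z x)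
  + subadj_bracket z (subadj_bracket x y) = 0.
Proof.
pose U x y z := x |> (y |> z) + z |> (y |> x) - [lie z, x |> y] - [lie x, z |> y].
have E (a b c : g) : subadj_bracket a (subadj_bracket b c)
    = U a b c - U b c a + [lie a, [lie b, c]].
  rewrite {1}/subadj_bracket subadj_pl /subadj_bracket /U.
  rewrite !plD !plN !lieDr !lieNr postlie_der (lieC (a |> b)).
  by zmod_cancel.
rewrite !E -(lie_jacobi x y z); zmod_cancel.
Qed.

End SubAdjacent.

(* The sub-adjacent Lie algebra lives on a copy of the underlying space, since
   g itself carries the Lie structure of the post-Lie algebra. *)
Definition subadj (K : fieldType) (g : postLieType K) : Type := g.
HB.instance Definition _ (K : fieldType) (g : postLieType K) :=
  GRing.Lmodule.copy (subadj g) g.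
HB.instance Definition _ (K : fieldType) (g : postLieType K) :=
  isLieAlgebra.Build K (subadj g) (@subadj_linearl K g) (@subadj_linearr K g)
    (@subadjxx K g) (@subadj_jacobi K g).

Section Obstruction.
Variables (K : fieldType) (g : postLieType K).
Implicit Types (x y z : g) (phi : {linear g -> g}).

Definition inner_postLie : Prop :=
  forall x, inner_derivation (postlie_prod x).

Definition implements phi : Prop := forall x y, x |> y = [lie phi x, y].

(* The subspaces of pairs (x, u) with x |> _ = [lie u, _] that are graphs of
   partial functions contain a maximal one, whose domain must be all of g. *)
Lemma inner_implements : inner_postLie -> exists phi, implements phi.
Proof.
move=> gI.
pose E (p : g * g) := forall y, p.1 |> y = [lie p.2, y].
have ED a p q : E p -> E q -> E (a *: p + q).
  move=> hp hq y /=; rewrite lieDl lieZl -hp -hq.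
  exact: postlie_linearl y a p.1 q.1.
pose P (G : set (g * g)) :=
  [/\ forall a p q, G p -> G q -> G (a *: p + q), forall p, G p -> E p
    & forall u, G (0, u) -> u = 0].
have [F FP Ftot|G [[GD GE G0] Gmax]] := @Zorn_bigcup _ P.
  split.
  - move=> a p q [X FX Xp] [Y FY Yq].
    have [XY|YX] := Ftot _ _ FX FY.
      by exists Y => //; have [YD _ _] := FP _ FY; apply: YD => //; apply: XY.
    by exists X => //; have [XD _ _] := FP _ FX; apply: XD => //; apply: YX.
  - by move=> p [X FX Xp]; have [_ XE _] := FP _ FX; apply: XE.
  - by move=> u [X FX Xu]; have [_ _ X0] := FP _ FX; apply: X0.
have Ginj x u v : G (x, u) -> G (x, v) -> u = v.
  move=> Gu Gv; apply/eqP; rewrite -subr_eq0 -[u - v]opprK opprB addrC.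
  rewrite -oppr_eq0 opprK; apply/eqP/G0.
  have -> : (0, - u + v) = (-1) *: (x, u) + (x, v) :> g * g.
    by congr (_, _) => /=; rewrite scaleN1r ?addNr.
  exact: GD.
have Gnil : G (0, 0).
  have [[p Gp]|] := pselect (exists p, G p).
    have -> : (0, 0) = (-1) *: p + p :> g * g.
      by case: p {Gp} => p1 p2; congr (_, _) => /=; rewrite scaleN1r addNr.
    exact: GD.
  move=> nG; exfalso; apply: (Gmax [set (0, 0)]%classic).
    split => [p Gp|sub]; first by case: nG; exists p.
    by apply: nG; exists (0, 0); apply: sub.
  split => [a p q -> ->|p -> y|u [->]] //; first by rewrite scaler0 addr0.
  by rewrite /= lie0l pl0l.
have Gtot x : exists u, G (x, u).
  apply: contrapT => nGx; have [u xu] := gI x.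
  pose H : set (g * g) := [set p | exists a q, G q /\ p = a *: (x, u) + q]%classic.
  apply: (Gmax H).
    split => [p Gp|HG]; first by exists 0, p; rewrite scale0r add0r.
    apply: nGx; exists u; apply: HG; exists 1, (0, 0); split => //.
    by rewrite scale1r addr0.
  split.
  - move=> a _ _ [b [p [Gp ->]]] [c [q [Gq ->]]].
    exists (a * b + c), (a *: p + q); split; first exact: GD.
    by rewrite scalerDr scalerA scalerDl addrACA.
  - by move=> _ [b [p [Gp ->]]]; apply: ED; [exact: xu | exact: GE].
  - move=> v [b [[q1 q2] [Gq [/= q10 vE]]]].
    have [b0|b0] := eqVneq b 0.
      by move: q10 vE; rewrite b0 !scale0r !add0r => q10 ->; apply: G0; rewrite [0]q10.
    case: nGx; exists (- b^-1 *: q2).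
    have -> : (x, - b^-1 *: q2) = (- b^-1) *: (q1, q2) + (0, 0) :> g * g.
      congr (_, _); rewrite /= addr0 //.
      have -> : q1 = - (b *: x) by apply/eqP; rewrite -addr_eq0 addrC -q10.
      by rewrite scalerN scaleNr opprK scalerA mulVf // scale1r.
    exact: GD.
pose f x := sval (cid (Gtot x)).
have fG x : G (x, f x) := svalP (cid (Gtot x)).
have flin : linear f by move=> a x y; apply: Ginj (fG _) (GD _ _ _ (fG x) (fG y)).
pose fL := GRing.isLinear.Build K g g *:%R f flin.
pose phi : {linear g -> g} := HB.pack f fL.
by exists phi => x y; apply: (GE _ (fG x)).
Qed.

Section Curvature.
Variables (phi : {linear g -> g}) (hphi : implements phi).

Lemma kappa_center (x y : subadj g) :
  [lie phi x, phi y] - phi [lie x, y] \in @lie_center K g.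
Proof.
apply/lie_centerP => z; rewrite lieDl lieNl lie_jacobil -!hphi.
by rewrite [[lie x, y]]/lie_bracket /= subadj_pl subrr.
Qed.

Definition kappa (x y : subadj g) : lie_centerT g :=
  Sub ([lie phi x, phi y] - phi [lie x, y]) (kappa_center x y).

Lemma val_kappa x y : val (kappa x y) = [lie phi x, phi y] - phi (subadj_bracket x y).
Proof. by []. Qed.

Lemma lie_phi_subadj x y z :
  [lie phi (subadj_bracket x y), z] = [lie [lie phi x, phi y], z].
Proof.
have /lie_centerP/(_ z) := kappa_center x y.
by rewrite lieDl lieNl => /eqP; rewrite subr_eq0 => /eqP <-.
Qed.

Lemma kappa_cocycle : kappa \in @cocycle2 K (subadj g) (lie_centerT g).
Proof.
have kxx x : kappa x x = 0.
  by apply: val_inj; rewrite val_kappa liexx subadjxx (raddf0 phi) subr0 (raddf0 val).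
have kl y : linear (fun x : subadj g => kappa x y).
  move=> a x x'; apply: val_inj.
  have -> : val (a *: kappa x y + kappa x' y)
      = a *: val (kappa x y) + val (kappa x' y) by exact: (linearP val).
  rewrite !val_kappa (subadj_linearl y a x x') !(linearP phi) lieDl lieZl.
  by rewrite scalerBr; zmod_cancel.
have kr x : linear (kappa x).
  move=> a y y'; apply: val_inj.
  have -> : val (a *: kappa x y + kappa x y')
      = a *: val (kappa x y) + val (kappa x y') by exact: (linearP val).
  rewrite !val_kappa (subadj_linearr x a y y') !(linearP phi) lieDr lieZr.
  by rewrite scalerBr; zmod_cancel.
apply/cocycle2P; split=> // x y z; apply: val_inj.
have -> : val (ce_d2 kappa x y z) = - val (kappa (subadj_bracket x y) z)
    + val (kappa (subadj_bracket x z) y) - val (kappa (subadj_bracket y z) x).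
  by rewrite /ce_d2 (raddfB val) (raddfD val) (raddfN val).
have hg := lie_ce (phi x) (phi y) (phi z).
have := congr1 phi (@lie_ce K (subadj g) x y z).
rewrite (raddf0 phi) (raddfB phi) (raddfD phi) (raddfN phi) => hs.
rewrite (raddf0 val) !val_kappa !lie_phi_subadj -[RHS]subr0 -{1}hg -hs.
by zmod_cancel.
Qed.

Definition kappa_cocycle2 : Z2 (subadj g) (lie_centerT g) := Sub kappa kappa_cocycle.

Definition kappa_class : H2 (subadj g) (lie_centerT g) := H2_class kappa_cocycle2.

End Curvature.

Lemma kappa_class_indep phi (hphi : implements phi) psi (hpsi : implements psi) :
  kappa_class hphi = kappa_class hpsi.
Proof.
have sZ x : phi x - psi x \in @lie_center K g.
  by apply/lie_centerP => y; rewrite lieDl lieNl -hphi -hpsi subrr.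
pose s (x : subadj g) : lie_centerT g := Sub (phi x - psi x) (sZ x).
have slin : linear s.
  move=> a x y; apply: val_inj.
  have -> : val (a *: s x + s y) = a *: val (s x) + val (s y) by exact: (linearP val).
  rewrite /= !(linearP phi) !(linearP psi) scalerBr; zmod_cancel.
pose sP := GRing.isLinear.Build K (subadj g) (lie_centerT g) *:%R s slin.
pose t : {linear subadj g -> lie_centerT g} := HB.pack s sP.
apply/eq_H2_class; exists t; apply/funext => x; apply/funext => y; apply: val_inj.
have -> : val ((val (kappa_cocycle2 hphi) - val (kappa_cocycle2 hpsi)) x y)
    = val (kappa hphi x y) - val (kappa hpsi x y) by exact: (raddfB val).
have -> : val (ce_d1 t x y) = - (phi (subadj_bracket x y) - psi (subadj_bracket x y)).
  exact: (raddfN val).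
have E : [lie phi x, phi y] = [lie psi x, psi y].
  rewrite -hpsi hphi; apply/eqP; rewrite -subr_eq0 -lieNr -lieDr lieC.
  by have /lie_centerP -> := sZ y; rewrite oppr0.
by rewrite !val_kappa E; zmod_cancel.
Qed.

(* The lift phi is picked by choice; obstruction_classE shows that every other
   lift gives the same class. *)
Definition obstruction_class (gI : inner_postLie) : H2 (subadj g) (lie_centerT g) :=
  kappa_class (svalP (cid (inner_implements gI))).

Lemma obstruction_classE (gI : inner_postLie) phi (hphi : implements phi) :
  obstruction_class gI = kappa_class hphi.
Proof. exact: kappa_class_indep. Qed.

End Obstruction.

(* Main.v *)
Require Import Defs.
From HB Require Import structures.
From mathcomp Require Import all_boot all_algebra.
From mathcomp Require Import boolp.

(** For a linear lift [phi] of the product, i.e. [x |> y = [lie phi x, y]], the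
    argument of [R] in the Rota-Baxter identity for [R := phi] is the
    sub-adjacent bracket of [x] and [y]. The identity therefore says that [phi]
    is a morphism of Lie algebras from the sub-adjacent algebra to [g], that is,
    that the cocycle [kappa] of [phi] vanishes identically
    ([rota_baxter1_kappa]).

    So the theorem asks when some lift has zero cocycle. Subtracting from a lift
    a linear map [t] with values in the center gives another lift, whose cocycle
    is the old one minus the coboundary of [t] ([kappa_central_shift]). Hence if
    the class of one lift is zero, its cocycle is a coboundary, and shifting by a
    primitive makes it vanish. Conversely a lift with zero cocycle has zero
    class, and the class is the same for all lifts. *)

Set Implicit Arguments.
Unset Strict Implicit.
Unset Printing Implicit Defensive.

Import GRing.Theory.
Local Open Scope ring_scope.

Section Lifts.
Variables (K : fieldType) (g : postLieType K) (phi : {linear g -> g}).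
Hypothesis hphi : implements phi.

Lemma subadj_bracket_implements (x y : g) :
  subadj_bracket x y = [lie phi x, y] + [lie x, phi y] + [lie x, y].
Proof. by rewrite /subadj_bracket !hphi (lieC x (phi y)). Qed.

(** The cocycle of [phi] is its failure to be multiplicative, and the previous
    identity turns multiplicativity into the Rota-Baxter relation. *)
Lemma rota_baxter1_kappa :
  rota_baxter1 phi <-> forall x y : subadj g, kappa hphi x y = 0.
Proof.
split=> [RB x y|k0 x y].
  by apply: val_inj; rewrite val_kappa subadj_bracket_implements RB subrr raddf0.
have /eqP := congr1 val (k0 x y).
by rewrite val_kappa raddf0 subr_eq0 subadj_bracket_implements => /eqP.
Qed.

Section CentralShift.
Variable t : {linear subadj g -> lie_centerT g}.

Definition central_shift (x : g) : g := phi x - val (t x).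

Fact central_shift_linear : linear central_shift.
Proof.
move=> a x y; rewrite /central_shift linearP.
have -> : val (t (a *: x + y)) = a *: val (t x) + val (t y).
  by rewrite -(linearP val) -linearP.
by rewrite scalerBr; zmod_cancel.
Qed.
HB.instance Definition _ :=
  GRing.isLinear.Build K g g *:%R central_shift central_shift_linear.

Lemma central_shift_implements : implements central_shift.
Proof.
move=> x y; have /lie_centerP tx0 := valP (t x).
by rewrite lieDl lieNl tx0 subr0 hphi.
Qed.

(** The brackets of the two lifts agree because a bracket ignores central terms,
    so the cocycle changes only through the term that is linear in the lift. *)
Lemma kappa_central_shift (x y : subadj g) :
  kappa central_shift_implements x y = kappa hphi x y - ce_d1 t x y.
Proof.
apply: val_inj.
have -> : val (kappa hphi x y - ce_d1 t x y)
    = val (kappa hphi x y) + val (t (subadj_bracket x y)).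
  by rewrite /ce_d1 opprK (raddfD val).
(* Both lifts induce the same product, so moving one argument of the bracket to
   the other side by antisymmetry lets each be exchanged in turn. *)
have E : [lie central_shift x, central_shift y] = [lie phi x, phi y].
  by rewrite -central_shift_implements hphi lieC -central_shift_implements hphi -lieC.
by rewrite !val_kappa E /central_shift /=; zmod_cancel.
Qed.

End CentralShift.
End Lifts.

Theorem theorem2p12 (K : fieldType) (g : postLieType K) (gI : inner_postLie g) :
  (exists R : {linear g -> g},
     rota_baxter1 R /\ forall x y : g, x |> y = [lie R x, y])
  <-> obstruction_class gI = 0.
Proof.
split=> [[R [RB hR]]|].
  rewrite (obstruction_classE gI hR); apply/H2_class_eq0.
  exists (\0 : {linear subadj g -> lie_centerT g}).
  apply/funext => x; apply/funext => y; rewrite /ce_d1 /= oppr0.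
  by have /rota_baxter1_kappa := RB; apply.
have [phi hphi] := inner_implements gI.
rewrite (obstruction_classE gI hphi) => /H2_class_eq0[t kt].
exists (central_shift phi t : {linear g -> g}).
split; last exact: (central_shift_implements hphi t).
apply/(rota_baxter1_kappa (central_shift_implements hphi t)) => x y.
rewrite kappa_central_shift; apply/eqP; rewrite subr_eq0; apply/eqP.
exact: (congr1 (fun w => w x y) kt).
Qed.
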